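(* Let $\Delta$ be a finite reduced root system in $V$ (notation as in the context), let $\emptyset\neq I\subset\{1,\ldots,r\}$, and suppose there exist $w_1\in\mathrm{Aut}(\Delta)$, $\mathbf{s}=(s_\alpha)_{\alpha\in\Delta_+}\in\mathcal{S}$ and $\mathbf{y}\in V$ such that $s_\alpha\in\mathbb{Z}$ for all $\alpha\in\Delta_{w_1^{-1}}$, $$\prod_{\alpha\in\Delta_{w_1^{-1}}}(-1)^{s_\alpha}=-1,$$ and $w_1^{-1}\mathbf{s}=\mathbf{s}$, $w_1^{-1}\mathbf{y}=\mathbf{y}$. Then $$S(\mathbf{s},\mathbf{y};I;\Delta)=\frac12\Bigl(\sum_{v\in W^I\setminus w_1W^I}\Bigl(\prod_{\alpha\in\Delta_{v^{-1}}}(-1)^{-s_\alpha}\Bigr)\zeta_r(v^{-1}\mathbf{s},v^{-1}\mathbf{y};\Delta)+\sum_{v\in W^I\setminus w_1^{-1}W^I}\Bigl(\prod_{\alpha\in\Delta_{v^{-1}}}(-1)^{-s_\alpha}\Bigr)\zeta_r(v^{-1}\mathbf{s},v^{-1}\mathbf{y};\Delta)\Bigr).$$ Furthermore, if $w_1^{-1}W^I=w_1W^I$, then $$S(\mathbf{s},\mathbf{y};I;\Delta)=\sum_{v\in W^I\setminus w_1W^I}\Bigl(\prod_{\alpha\in\Delta_{v^{-1}}}(-1)^{-s_\alpha}\Bigr)\zeta_r(v^{-1}\mathbf{s},v^{-1}\mathbf{y};\Delta).$$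
   Context: $V$ is an $r$-dimensional real vector space with inner product $\langle\cdot,\cdot\rangle$, identified with its dual. $\Delta\subset V$ is a finite reduced root system (not necessarily irreducible) with fundamental system $\Psi=\{\alpha_1,\ldots,\alpha_r\}$, positive roots $\Delta_+$ and negative roots $\Delta_-=-\Delta_+$. For $\alpha\in\Delta$, $\alpha^\vee=2\alpha/\langle\alpha,\alpha\rangle$. The fundamental weights $\lambda_1,\dots,\lambda_r$ satisfy $\langle\alpha_i^\vee,\lambda_j\rangle=\delta_{ij}$; $P=\bigoplus_i\mathbb{Z}\lambda_i$, $P_{++}=\bigoplus_i\mathbb{N}\lambda_i$. $\sigma_\alpha(v)=v-\langle\alpha^\vee,v\rangle\alpha$, $W$ is the Weyl group generated by the $\sigma_\alpha$, and $\mathrm{Aut}(\Delta)$ is the group of all elements of $GL(V)$ stabilizing $\Delta$ (it acts on $V$ and contains $W$). For $w\in\mathrm{Aut}(\Delta)$, $\Delta_w=\Delta_+\cap w^{-1}\Delta_-$. For $\mathbf{s}=(s_\alpha)_{\alpha\in\Delta_+}\in\mathbb{C}^{|\Delta_+|}$, set $s_{-\alpha}=s_\alpha$ and define $(w\mathbf{s})_\alpha=s_{w^{-1}\alpha}$. Complex powers of nonzero reals are taken with the convention $x^{s}=|x|^se^{\pi i s}$ for $x<0$, and $(-1)^{\pm s}=e^{\pm\pi i s}$. The zeta-function of the root system is $$\zeta_r(\mathbf{s},\mathbf{y};\Delta)=\sum_{\lambda\in P_{++}}e^{2\pi i\langle\mathbf{y},\lambda\rangle}\prod_{\alpha\in\Delta_+}\frac{1}{\langle\alpha^\vee,\lambda\rangle^{s_\alpha}},$$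 absolutely convergent on $\mathcal{S}=\{\mathbf{s}:\Re s_\alpha>1\text{ for all }\alpha\in\Delta_+\}$. For $\emptyset\ne I\subset\{1,\dots,r\}$: $V_I$ is the span of $\{\alpha_i:i\in I\}$, $\Delta_I=\Delta\cap V_I$, $\Delta_{I+}=\Delta_I\cap\Delta_+$, $\Delta^\vee_{I+}=\{\alpha^\vee:\alpha\in\Delta_{I+}\}$, $\Delta^\vee_+=\{\alpha^\vee:\alpha\in\Delta_+\}$; $P_{I+}=\bigoplus_{i\in I}\mathbb{N}_0\lambda_i$; $\iota^*:P\to\bigoplus_{i\in I}\mathbb{Z}\lambda_i$ is the projection $\sum_j m_j\lambda_j\mapsto\sum_{i\in I}m_i\lambda_i$; $W^I=\{w\in W:\Delta^\vee_{I+}\subset w\Delta^\vee_+\}$. With $H=\{v\in V:\langle\alpha^\vee,v\rangle=0\text{ for some }\alpha\in\Delta\}$, $$S(\mathbf{s},\mathbf{y};I;\Delta)=\sum_{\lambda\in\iota^{*-1}(P_{I+})\setminus H}e^{2\pi i\langle\mathbf{y},\lambda\rangle}\prod_{\alpha\in\Delta_+}\frac{1}{\langle\alpha^\vee,\lambda\rangle^{s_\alpha}}.$$ *)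

(* Defs.v *)
From HB Require Import structures.
From mathcomp Require Import all_boot all_order all_algebra finmap.
From mathcomp Require Import sesquilinear complex.
From mathcomp Require Import all_classical all_reals all_analysis.
From mathcomp Require Import summability.

Set Implicit Arguments.
Unset Strict Implicit.
Unset Printing Implicit Defensive.
Import Order.TTheory GRing.Theory Num.Theory.
Import numFieldNormedType.Exports.

Local Open Scope classical_set_scope.
Local Open Scope ring_scope.
Local Open Scope complex_scope.

Definition cexp (R : realType) (z : R[i]) : R[i] :=
  (expR (complex.Re z))%:C *
  (cos (complex.Im z) +i* sin (complex.Im z)).

(* x ^ s for a nonzero real x, with argument pi on the negative half-line;
   in particular cpow (-1) s = e^(pi i s).  The value at x = 0 is junk. *)
Definition cpow (R : realType) (x : R) (s : R[i]) : R[i] :=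
  cexp (s * (ln `|x|)%:C) * (if x < 0 then cexp (s * (0 +i* pi)) else 1).

(* Unconditional sum of f over A: the limit of the sums over finite sets,
   directed by inclusion.  [R[i]^o] is R[i] as a normed space over itself. *)
Definition csum (R : realType) (T : choiceType) (A : set T) (f : T -> R[i]) :
    R[i] :=
  summability.sum (patch (fun=> 0) A f : T -> R[i]^o).

Section RootSystem.
Variables (R : realType) (V : vectType R) (dot : {dot V for idfun}).
Implicit Types (a b v y : V) (w : 'End(V)) (s : V -> R[i]).

Definition coroot a : V := (2 / dot a a) *: a.

Definition reflection a : 'End(V) :=
  linfun (fun v => v - dot (coroot a) v *: a).

Lemma reflectionE a v : reflection a v = v - dot (coroot a) v *: a.
Proof.
set f := fun u => u - dot (coroot a) u *: a.
have lf : linear f.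
  move=> c x z; rewrite /f linearDr linearZr /= scalerDl scalerBr scalerA.
  by rewrite opprD addrACA.
pose F : {linear V -> V} :=
  HB.pack f (GRing.isLinear.Build R V V _ f lf).
exact: (lfunE F v).
Qed.

Definition is_reduced_root_system (Delta : {fset V}) : Prop :=
  [/\ 0 \notin Delta,
      <<Delta>>%VS = fullv,
      forall a b, a \in Delta -> b \in Delta -> reflection a b \in Delta,
      forall a b, a \in Delta -> b \in Delta ->
        dot (coroot a) b \is a Num.int
    & forall a (c : R), a \in Delta -> c *: a \in Delta -> c = 1 \/ c = -1].

Definition is_fundamental_system (Delta : {fset V}) (r : nat)
    (Psi : r.-tuple V) : Prop :=
  [/\ basis_of fullv Psi,
      forall i, tnth Psi i \in Delta
    & forall a, a \in Delta ->
        (forall i, coord Psi i a \is a Num.nat) \/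
        (forall i, - coord Psi i a \is a Num.nat)].

Definition are_fundamental_weights (r : nat) (Psi lam : r.-tuple V) : Prop :=
  forall i j, dot (coroot (tnth Psi i)) (tnth lam j) = (i == j)%:R.

Definition AutD (Delta : {fset V}) : set 'End(V) :=
  [set w | lker w = 0%VS /\ [fset w a | a in Delta]%fset = Delta].

(* Reflections being involutions, the monoid they generate is the group. *)
Inductive Weyl (Delta : {fset V}) : set 'End(V) :=
| Weyl_id : Weyl Delta \1%VF
| Weyl_refl a w :
    a \in Delta -> Weyl Delta w -> Weyl Delta (reflection a \o w)%VF.

Variables (Delta : {fset V}) (r : nat) (Psi lam : r.-tuple V).

Definition pos_roots : {fset V} :=
  [fset a in Delta | [forall i, 0 <= coord Psi i a]]%fset.

Definition neg_roots : {fset V} := [fset - a | a in pos_roots]%fset.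

Definition Delta_ w : {fset V} :=
  (pos_roots `&` [fset (w^-1)%VF b | b in neg_roots])%fset.

(* A family indexed by Delta_+ is given by a function s on V of which only the
   values on Delta_+ matter; [extend] imposes s_{-a} = s_a. *)
Definition extend s a : R[i] := if a \in pos_roots then s a else s (- a).

Definition act w s : V -> R[i] := fun a => extend s ((w^-1)%VF a).

Definition abs_conv_region : set (V -> R[i]) :=
  [set s | forall a, a \in pos_roots -> 1 < complex.Re (s a)].

Definition weights : set V :=
  [set v | exists m : 'I_r -> int, v = \sum_j (m j)%:~R *: tnth lam j].

Definition strictly_dominant_weights : set V :=
  [set v | exists m : 'I_r -> nat,
     (forall j, (0 < m j)%N) /\ v = \sum_j (m j)%:R *: tnth lam j].

Definition summand s y v : R[i] :=
  cexp (0 +i* (2 * pi * dot y v)) *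
  \prod_(a <- pos_roots) (cpow (dot (coroot a) v) (s a))^-1.

Definition zeta s y : R[i] := csum strictly_dominant_weights (summand s y).

Definition walls : set V :=
  [set v | exists2 a, a \in Delta & dot (coroot a) v = 0].

Variable I : {set 'I_r}.

Definition V_I : {vspace V} := (\sum_(i in I) <[tnth Psi i]>)%VS.

Definition pos_roots_I : {fset V} :=
  ([fset a in Delta | a \in V_I] `&` pos_roots)%fset.

Definition P_Iplus : set V :=
  [set v | exists m : 'I_r -> nat, v = \sum_(i in I) (m i)%:R *: tnth lam i].

Definition iota_star v : V := \sum_(i in I) coord lam i v *: tnth lam i.

Definition W_I : set 'End(V) :=
  [set w | Weyl Delta w /\
    ([fset coroot a | a in pos_roots_I] `<=`
       [fset w b | b in [fset coroot a | a in pos_roots]])%fset].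

Definition S_sum s y : R[i] :=
  csum ((weights `&` iota_star @^-1` P_Iplus) `\` walls) (summand s y).

End RootSystem.

(* Main.v *)
(* Every regular weight lies in w P_++ for exactly one Weyl element w, and
   P_++-positivity on the roots of I selects exactly the w in W^I.  Hence S is
   the sum over w in W^I of the sums of its terms over w P_++, and substituting
   lambda = w mu, while keeping track of the sign changes of the coroots, turns
   each of these into the term of zeta_r attached to w.
   If w_1 is not in W, neither w_1 W^I nor w_1^-1 W^I meets W^I and nothing
   remains to be shown; in particular w_1 is only ever needed to be an isometry
   when it lies in W.  If w_1 is in W, its hypotheses say that lambda -> w_1 lambda
   changes the sign of each term of S, so the chambers v and w_1 v cancel, and
   v -> w_1 v maps the intersection of W^I and w_1^-1 W^I onto that of W^I and
   w_1 W^I. *)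
Require Import Defs.
From HB Require Import structures.
From mathcomp Require Import all_boot all_order all_algebra finmap.
From mathcomp Require Import sesquilinear complex.
From mathcomp Require Import all_classical all_reals all_analysis.
From mathcomp Require Import summability ring lra.

Set Implicit Arguments.
Unset Strict Implicit.
Unset Printing Implicit Defensive.
Import Order.TTheory GRing.Theory Num.Theory.
Import numFieldNormedType.Exports.

Local Open Scope classical_set_scope.
Local Open Scope ring_scope.
Local Open Scope complex_scope.

(** * Unconditional sums *)

Section UnconditionalSums.
Variables (K : numFieldType) (E : normedModType K) (T : choiceType).
Implicit Types (f g : T -> E) (l : E).

#[local] Existing Instance summability.totally_filter.

(** A limit takes a default value when there is no convergence, so sums are handled through this
    predicate; [has_usum_unique] returns to [summability.sum]. *)
Definition has_usum f l : Prop :=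
  summability.partial_sum f @ summability.totally --> l.

Lemma partial_sumE f (F : {fset T}) :
  summability.partial_sum f F = \sum_(x <- F) f x.
Proof. by rewrite /summability.partial_sum big_seq_fsetE. Qed.

Lemma has_usum_unique f l : has_usum f l -> summability.sum f = l.
Proof. by move=> h; apply: (cvg_lim _ h); apply: norm_hausdorff. Qed.

Lemma has_usumZ (c : K) f l :
  has_usum f l -> has_usum (fun x => c *: f x) (c *: l).
Proof.
move=> h; rewrite /has_usum (_ : summability.partial_sum _ =
   (fun F => c *: summability.partial_sum f F)); first exact: cvgZr.
by apply/funext => F; rewrite !partial_sumE scaler_sumr.
Qed.

Lemma has_usumD f g l m :
  has_usum f l -> has_usum g m -> has_usum (fun x => f x + g x) (l + m).
Proof.
move=> hf hg; rewrite /has_usum (_ : summability.partial_sum _ =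
  summability.partial_sum f \+ summability.partial_sum g); first exact: cvgD.
by apply/funext => F; rewrite /= !partial_sumE big_split.
Qed.

Lemma has_usum0 : has_usum (fun=> 0) 0.
Proof.
rewrite /has_usum (_ : summability.partial_sum _ = cst 0); first exact: cvg_cst.
by apply/funext => F; rewrite partial_sumE big1.
Qed.

Lemma has_usum_sum (J : eqType) (s : seq J) (f : J -> T -> E) (l : J -> E) :
  (forall j, j \in s -> has_usum (f j) (l j)) ->
  has_usum (fun x => \sum_(j <- s) f j x) (\sum_(j <- s) l j).
Proof.
elim: s => [|j s IHs] h.
  rewrite big_nil (_ : (fun _ => _) = (fun=> 0)); first exact: has_usum0.
  by apply/funext => x; rewrite big_nil.
rewrite big_cons (_ : (fun _ => _) = (fun x => f j x + \sum_(i <- s) f i x)).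
  apply: has_usumD; first by apply: h; rewrite mem_head.
  by apply: IHs => i js; apply: h; rewrite in_cons js orbT.
by apply/funext => x; rewrite big_cons.
Qed.

(** A partial sum of [f \o h] over [F] is one of [f] over the image of [F], and a bijection respects
    inclusion of finite sets. *)
Lemma has_usum_reindex (h g : T -> T) f l : cancel h g -> cancel g h ->
  has_usum f l -> has_usum (f \o h) l.
Proof.
move=> hK gK fl.
rewrite /has_usum (_ : summability.partial_sum _ =
   summability.partial_sum f \o (fun F => [fset h x | x in F]%fset)); last first.
  apply/funext => F; rewrite /= !partial_sumE big_imfset //=.
  by move=> x y _ _; apply: can_inj hK _ _.
apply: cvg_comp fl => P [F _ FP].
(* A set containing the image of [F] under [g] has an image under [h] containing [F]. *)
exists [fset g x | x in F]%fset => // G /= FG; apply: FP => /=.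
apply/fsubsetP => x xF; apply/imfsetP; exists (g x); rewrite //= ?gK //.
by apply: (fsubsetP FG); apply/imfsetP; exists x.
Qed.

End UnconditionalSums.

(** * Convergence by domination, real and complex *)

Section AbsoluteSums.
Variables (R : realType) (T : choiceType).

#[local] Existing Instance summability.totally_filter.

(** The partial sums increase with the finite set, so they tend to their supremum. *)
Lemma real_usum_ge0 (f : T -> R) (C : R) :
  (forall x, 0 <= f x) -> (forall F : {fset T}, \sum_(x <- F) f x <= C) ->
  exists l : R, has_usum (f : T -> R^o) l.
Proof.
move=> f0 fC.
pose E := range (fun F : {fset T} => \sum_(x <- F) f x).
have supE : has_sup E.
  split; first by exists (\sum_(x <- fset0) f x); exists fset0.
  by exists C => _ [F _ <-].
exists (sup E); apply/cvgrPdist_lt => /= e e0.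
have [_ [F _ <-] Fe] := sup_adherent e0 supE.
exists F => // G /= FG; rewrite partial_sumE.
have GE : \sum_(x <- G) f x <= sup E by apply: ub_le_sup; [case: supE | exists G].
rewrite ger0_norm ?subr_ge0 // ltrBlDl -ltrBlDr (lt_le_trans Fe) //.
(* Extending the sum over [F] by zeros to [G] makes the comparison termwise. *)
rewrite (eq_big_seq (fun x => if x \in F then f x else 0)); last by move=> x ->.
rewrite (big_fset_incl _ FG) => [|x _ /negPf -> //].
by apply: ler_sum => x _; case: ifP.
Qed.

(** Here [f] is the difference of [g + f] and [g], both nonnegative with bounded partial sums. *)
Lemma real_usum_bounded (f g : T -> R) (C : R) :
  (forall x, `|f x| <= g x) -> (forall F : {fset T}, \sum_(x <- F) g x <= C) ->
  exists l : R, has_usum (f : T -> R^o) l.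
Proof.
move=> fg gC.
have g0 x : 0 <= g x by apply: le_trans (fg x).
have [l1 h1] : exists l : R, has_usum ((fun x => g x + f x) : T -> R^o) l.
  apply: (@real_usum_ge0 _ (C + C)) => [x|F].
    by have := fg x; rewrite ler_norml => /andP[]; lra.
  rewrite big_split /= lerD // (le_trans _ (gC F)) // ler_sum // => x _.
  exact: le_trans (ler_norm _) (fg x).
have [l2 h2] := real_usum_ge0 g0 gC.
exists (l1 + (-1) *: l2).
have := has_usumD h1 (has_usumZ (c := -1) h2); congr has_usum.
by apply/funext => x; rewrite scaleN1r addrAC subrr add0r.
Qed.

Lemma norm_Re (z : R[i]) : (`|complex.Re z|)%:C <= `|z|.
Proof.
case: z => a b; rewrite normc_def lecR /= -sqrtr_sqr ler_wsqrtr //.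
by rewrite lerDl sqr_ge0.
Qed.

Lemma norm_Im (z : R[i]) : (`|complex.Im z|)%:C <= `|z|.
Proof.
case: z => a b; rewrite normc_def lecR /= -sqrtr_sqr ler_wsqrtr //.
by rewrite lerDr sqr_ge0.
Qed.

Lemma norm_le_ReIm (z : R[i]) :
  `|z| <= (`|complex.Re z| + `|complex.Im z|)%:C.
Proof.
case: z => a b; rewrite normc_def lecR /= -[leRHS]ger0_norm ?addr_ge0 //.
rewrite -sqrtr_sqr ler_wsqrtr // sqrrD !real_normK ?num_real //.
by rewrite addrAC lerDl mulrn_wge0 // mulr_ge0.
Qed.

Lemma Re_sum (F : {fset T}) (f : T -> R[i]) :
  complex.Re (\sum_(x <- F) f x) = \sum_(x <- F) complex.Re (f x).
Proof. by apply: (big_morph (@complex.Re R)) => // -[a b] [c d]. Qed.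

Lemma Im_sum (F : {fset T}) (f : T -> R[i]) :
  complex.Im (\sum_(x <- F) f x) = \sum_(x <- F) complex.Im (f x).
Proof. by apply: (big_morph (@complex.Im R)) => // -[a b] [c d]. Qed.

Lemma usum_bounded (f : T -> R[i]) (g : T -> R) (C : R) :
  (forall x, `|f x| <= (g x)%:C) -> (forall F : {fset T}, \sum_(x <- F) g x <= C) ->
  exists l : R[i], has_usum (f : T -> R[i]^o) l.
Proof.
move=> fg gC.
have [a ha] : exists l : R, has_usum ((fun x => complex.Re (f x)) : T -> R^o) l.
  by apply: real_usum_bounded gC => x; rewrite -lecR (le_trans (norm_Re _)).
have [b hb] : exists l : R, has_usum ((fun x => complex.Im (f x)) : T -> R^o) l.
  by apply: real_usum_bounded gC => x; rewrite -lecR (le_trans (norm_Im _)).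
exists (a +i* b); apply/cvgrPdist_lt => -[e e'].
(* Positive in [R[i]] means real and positive, so the radius is a real number. *)
rewrite ltcE /= => /andP[/eqP -> e0].
have e20 : 0 < e / 2 by rewrite divr_gt0.
move/cvgrPdist_lt: ha => /(_ _ e20) haF; move/cvgrPdist_lt: hb => /(_ _ e20) hbF.
near=> F.
have ha : `|a - complex.Re (\sum_(x <- F) f x)| < e / 2.
  by near: F; apply: filterS haF => F; rewrite partial_sumE Re_sum.
have hb : `|b - complex.Im (\sum_(x <- F) f x)| < e / 2.
  by near: F; apply: filterS hbF => F; rewrite partial_sumE Im_sum.
rewrite partial_sumE (le_lt_trans (norm_le_ReIm _)) // ltcR.
case: (\sum_(x <- F) f x) ha hb => c d /= ha hb.
by rewrite [ltRHS]splitr ltrD.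
Unshelve. all: by end_near.
Qed.

End AbsoluteSums.

(** * Bounds for p-series and for products of them *)

Section ProductBound.
Variable R : realType.

(* [x^(-a)] *)
Local Notation h a x := (expR (- (a * ln x))).

(** Discrete form of the fact that x^(-a) is the derivative of -x^(1-a)/(a-1), obtained from ln(1+x)
    <= x and 1+x <= exp x. It makes the partial sums telescope. *)
Lemma pseries_step (a : R) (k : nat) : 1 < a ->
  (a - 1) * h a k.+2%:R <= h (a - 1) k.+1%:R - h (a - 1) k.+2%:R.
Proof.
move=> a1; set t := a - 1; have t0 : 0 < t by rewrite subr_gt0.
have k1 : 0 < (k.+1%:R : R) by rewrite ltr0n.
have k2 : 0 < (k.+2%:R : R) by rewrite ltr0n.
have dln : k.+2%:R^-1 <= ln (k.+2%:R : R) - ln k.+1%:R.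
  have : ln (1 + - (k.+2%:R : R)^-1) <= - k.+2%:R^-1.
    by apply: le_ln1Dx; rewrite ltrNl opprK invf_lt1 // ltr1n.
  rewrite (_ : 1 + _ = k.+1%:R / k.+2%:R); last first.
    have E : k.+2%:R = k.+1%:R + 1 :> R by rewrite -addn1 natrD.
    by rewrite E in k2 *; field; exact: lt0r_neq0.
  by rewrite ln_div ?posrE // lerNr opprB.
have -> : h a k.+2%:R = h t k.+2%:R / k.+2%:R.
  rewrite -[X in _ / X](lnK k2) -expRN -expRD /t; congr expR; ring.
have -> : h t k.+1%:R = h t k.+2%:R * expR (t * (ln (k.+2%:R : R) - ln k.+1%:R)).
  by rewrite -expRD; congr expR; ring.
rewrite -[X in _ <= _ - X]mulr1 -mulrBr mulrCA ler_pM2l ?expR_gt0 //.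
rewrite lerBrDl (le_trans _ (expR_ge1Dx _)) // lerD2l ler_pM2l //.
Qed.

Lemma pseries_bound (a : R) : 1 < a ->
  exists C : R, forall N, \sum_(k < N) h a k.+1%:R <= C.
Proof.
move=> a1; have t0 : 0 < a - 1 by rewrite subr_gt0.
(* The term k = 0 contributes a - 1; the others telescope to at most 1 - (N+1)^(1-a). *)
have bnd N : (a - 1) * \sum_(k < N.+1) h a k.+1%:R <= (a - 1) + 1 - h (a - 1) N.+1%:R.
  elim: N => [|N IHN]; first by rewrite big_ord1 ln1 !mulr0 oppr0 expR0; lra.
  rewrite big_ord_recr /= mulrDr.
  by have := pseries_step N a1; lra.
exists (a / (a - 1)) => N; rewrite ler_pdivlMr // mulrC.
have : (a - 1) * \sum_(k < N.+1) h a k.+1%:R <= a.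
  by apply: le_trans (bnd N) _; have := expR_gt0 (- ((a - 1) * ln (N.+1%:R : R))); lra.
apply: le_trans; rewrite ler_pM2l // big_ord_recr /= lerDl; exact/ltW/expR_gt0.
Qed.

(** As [m] is injective on [D], the part of a finite set lying in [D] embeds into a box of indices,
    over which the sum factors into [r] partial sums of p-series. *)
Lemma prod_pseries_bound (r : nat) (T : choiceType) (D : set T)
    (m : T -> 'I_r -> nat) (a : 'I_r -> R) :
  (forall i, 1 < a i) ->
  (forall x y, D x -> D y -> m x =1 m y -> x = y) ->
  exists C : R, forall F : {fset T},
    \sum_(x <- F) patch (fun=> 0) D (fun x => \prod_i h (a i) (m x i).+1%:R) x <= C.
Proof.
move=> a1 minj.
have [C hC] : {C : 'I_r -> R & forall i N, \sum_(k < N) h (a i) k.+1%:R <= C i}.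
  exists (fun i => xget 0 [set c | forall N, \sum_(k < N) h (a i) k.+1%:R <= c]) => i.
  by apply: (@xgetPex _ 0 [set c | forall N, \sum_(k < N) h (a i) k.+1%:R <= c]);
    exact: pseries_bound.
exists (\prod_i C i) => F.
(* [N] bounds every index occurring in [F], so that [inord] in [phi] loses nothing. *)
pose N := \max_(x <- F) \max_i m x i.
have mN x i : x \in F -> (m x i <= N)%N.
  move=> xF; apply: leq_trans (leq_bigmax_seq _ xF isT).
  exact: leq_bigmax.
pose phi x : {ffun 'I_r -> 'I_N.+1} := [ffun i => inord (m x i)].
pose G (p : {ffun 'I_r -> 'I_N.+1}) := \prod_i h (a i) (p i).+1%:R.
have G0 p : 0 <= G p by apply: prodr_ge0 => i _; exact/ltW/expR_gt0.
pose s := [seq x <- F | x \in D].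
have -> : \sum_(x <- F) patch (fun=> 0) D (fun x => \prod_i h (a i) (m x i).+1%:R) x
    = \sum_(p <- map phi s) G p.
  rewrite big_map big_filter big_mkcond [RHS]big_mkcond /=.
  rewrite big_seq [RHS]big_seq; apply: eq_bigr => x xF.
  rewrite patchE; case: ifP => // _; apply: eq_bigr => i _.
  by rewrite ffunE inordK // ltnS mN.
have us : uniq (map phi s).
  rewrite map_inj_in_uniq ?filter_uniq ?fset_uniq // => x z.
  rewrite !mem_filter => /andP[/set_mem xD xF] /andP[/set_mem zD zF] e.
  apply: minj => // i; have := congr1 (fun p : {ffun _ -> _} => val (p i)) e.
  by rewrite !ffunE /= !inordK // ltnS mN.
rewrite big_uniq //= (@le_trans _ _ (\sum_p G p)) //.
  by rewrite big_mkcond ler_sum // => p _; case: ifP.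
(* Distributivity turns the sum over the box into a product of one-variable sums. *)
rewrite -(bigA_distr_bigA (fun i (k : 'I_N.+1) => h (a i) k.+1%:R)) /=.
apply: ler_prod => i _; rewrite hC andbT sumr_ge0 // => k _; exact/ltW/expR_gt0.
Qed.

End ProductBound.

(** * Complex powers *)

Section ComplexPowers.
Variable R : realType.
Implicit Types (z s : R[i]) (x : R).

Lemma cexpD z1 z2 : cexp (z1 + z2) = cexp z1 * cexp z2.
Proof.
case: z1 z2 => [a b] [c d]; rewrite /cexp /= expRD cosD sinD.
by apply/eqP; rewrite eq_complex /=; apply/andP; split; apply/eqP; ring.
Qed.

Lemma cexp0 : cexp 0 = 1 :> R[i].
Proof. by rewrite /cexp /= expR0 cos0 sin0 mul1r. Qed.

Lemma cexpN z : cexp (- z) = (cexp z)^-1.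
Proof.
have e : cexp (- z) * cexp z = 1 by rewrite -cexpD addNr cexp0.
have nz : cexp z != 0.
  by apply/eqP => z0; move: e; rewrite z0 mulr0 => /esym/eqP; rewrite oner_eq0.
by rewrite -[RHS]mul1r -e mulfK.
Qed.

Lemma norm_cexp z : `|cexp z| = (expR (complex.Re z))%:C.
Proof.
case: z => a b; rewrite /cexp normrM [X in _ * X]normc_def /= cos2Dsin2 sqrtr1.
by rewrite mulr1 normc_def /= expr0n /= addr0 sqrtr_sqr ger0_norm ?expR_ge0.
Qed.

Lemma cpowN1 s : cpow (-1) s = cexp (s * (0 +i* pi)).
Proof.
by rewrite /cpow normrN1 ln1 mulr0 cexp0 mul1r oppr_lt0 ltr01.
Qed.

Lemma cpowN1N s : cpow (-1) (- s) = (cpow (-1) s)^-1.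
Proof. by rewrite !cpowN1 mulNr cexpN. Qed.

Lemma cexp_ipi_nat (n : nat) : cexp (n%:R * (0 +i* pi)) = (-1) ^+ n :> R[i].
Proof.
elim: n => [|n IHn]; first by rewrite mul0r cexp0.
rewrite -addn1 natrD mulrDl cexpD IHn mul1r exprD; congr (_ * _).
rewrite /cexp /= expR0 cospi sinpi expr1.
by apply/eqP; rewrite eq_complex /= !mul1r !mul0r subr0 addr0 oppr0 !eqxx.
Qed.

Lemma cpowN1_int_sqr (m : int) : cpow (-1) (m%:~R) * cpow (-1) (m%:~R) = 1 :> R[i].
Proof.
rewrite cpowN1; case: m => n.
  by rewrite -pmulrn cexp_ipi_nat -expr2 sqrr_sign.
by rewrite NegzE mulrNz mulNr cexpN -pmulrn cexp_ipi_nat -expr2 exprVn sqrr_sign invr1.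
Qed.

Lemma cpow_opp_pos x s : 0 < x -> cpow (- x) s = cpow x s * cpow (-1) s.
Proof.
move=> x0; rewrite cpowN1 /cpow normrN oppr_lt0 x0 ltNge ltW //=.
by rewrite mulr1.
Qed.

(** For negative [x], the rule for positive numbers applied to [- x] puts the factor (-1)^s on the
    other side; for integral [s] this factor is its own inverse. *)
Lemma cpow_opp_int x s : x != 0 -> (exists m : int, s = m%:~R) ->
  cpow (- x) s = cpow x s * cpow (-1) s.
Proof.
move=> x0 [m ->]; have [x_gt0|x_le0] := ltP 0 x; first exact: cpow_opp_pos.
have nx : 0 < - x by rewrite oppr_gt0 lt_neqAle x0.
by rewrite -{2}(opprK x) (cpow_opp_pos _ nx) -mulrA cpowN1_int_sqr mulr1.
Qed.

Lemma norm_cpow_pos x s : 0 < x ->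
  `|cpow x s| = (expR (complex.Re s * ln x))%:C.
Proof.
move=> x0; rewrite /cpow ltNge ltW //= mulr1 norm_cexp gtr0_norm //.
by case: s => a b /=; rewrite mulr0 subr0.
Qed.

Lemma norm_cexp_im x : `|cexp (0 +i* x)| = 1 :> R[i].
Proof. by rewrite norm_cexp /= expR0. Qed.

End ComplexPowers.

(** * Reflections and Weyl chambers *)

Section InnerProduct.
Variables (R : realType) (V : vectType R) (dot : {dot V for idfun}).
Implicit Types (a b u v : V) (w : 'End(V)).

Lemma dotC u v : dot u v = dot v u.
Proof. by rewrite hermC expr0 mul1r. Qed.

Lemma dotDr u v z : dot u (v + z) = dot u v + dot u z.
Proof. exact: linearDr. Qed.

Lemma dotZr c u v : dot u (c *: v) = c * dot u v.
Proof. exact: linearZr. Qed.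

Lemma dotDl u v z : dot (u + v) z = dot u z + dot v z.
Proof. by rewrite ![dot _ z]dotC dotDr. Qed.

Lemma dotZl c u v : dot (c *: u) v = c * dot u v.
Proof. by rewrite ![dot _ v]dotC dotZr. Qed.

Lemma dotNr u v : dot u (- v) = - dot u v.
Proof. by rewrite -scaleN1r dotZr mulN1r. Qed.

Lemma dotNl u v : dot (- u) v = - dot u v.
Proof. by rewrite dotC dotNr dotC. Qed.

Lemma dot0r u : dot u 0 = 0.
Proof. by rewrite -(scale0r 0) dotZr mul0r. Qed.

Lemma dot_sumr (J : finType) (P : pred J) (F : J -> V) u :
  dot u (\sum_(i | P i) F i) = \sum_(i | P i) dot u (F i).
Proof. by apply: (big_morph (dot u)) => [x z|]; [exact: dotDr | exact: dot0r]. Qed.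

Lemma dot_gt0 a : a != 0 -> 0 < dot a a.
Proof. exact: neq0_dnorm_gt0. Qed.

Local Notation cor a v := (dot (coroot dot a) v).
Local Notation refl := (reflection dot).

Lemma corE a v : cor a v = 2 / dot a a * dot a v.
Proof. by rewrite /coroot dotZl. Qed.

Lemma corN a v : cor (- a) v = - cor a v.
Proof. by rewrite !corE !dotNl dotNr opprK mulrN. Qed.

Lemma cor_gt0 a v : a != 0 -> (0 < cor a v) = (0 < dot a v).
Proof. by move=> a0; rewrite corE pmulr_rgt0 // divr_gt0 // dot_gt0. Qed.

Lemma cor_self a : a != 0 -> cor a a = 2.
Proof. by move=> a0; rewrite corE divfK // gt_eqF // dot_gt0. Qed.

Lemma corootK a : a != 0 -> coroot dot (coroot dot a) = a.
Proof.
move=> /dot_gt0 a0; rewrite /coroot dotZl dotZr scalerA.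
by rewrite (_ : _ * _ = 1) ?scale1r //; field; rewrite gt_eqF.
Qed.


Lemma reflN a : refl (- a) = refl a.
Proof. by apply/lfunP => v; rewrite !reflectionE corN scalerN scaleNr opprK. Qed.

Lemma refl_self a : a != 0 -> refl a a = - a.
Proof.
move=> a0; rewrite reflectionE cor_self // scaler_nat mulr2n.
by rewrite opprD addrA subrr sub0r.
Qed.

Lemma cor_refl a v : a != 0 -> cor a (refl a v) = - cor a v.
Proof.
by move=> a0; rewrite reflectionE dotDr dotNr dotZr cor_self //; ring.
Qed.

Lemma reflK a : a != 0 -> involutive (refl a).
Proof.
move=> a0 v; rewrite reflectionE cor_refl // reflectionE scaleNr opprK.
by rewrite subrK.
Qed.

Definition isometric w := forall u v, dot (w u) (w v) = dot u v.

Lemma refl_isometric a : a != 0 -> isometric (refl a).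
Proof.
move=> a0 u v; rewrite !reflectionE !corE !(dotDl, dotDr, dotNl, dotNr, dotZl, dotZr).
by rewrite (dotC u a); field; rewrite gt_eqF // dot_gt0.
Qed.

Lemma isometric_lker w : isometric w -> lker w == 0%VS.
Proof.
move=> iw; apply/lker0P => u v uv; apply/eqP; rewrite -subr_eq0.
apply: contraT => /dot_gt0; rewrite -iw (_ : w (u - v) = 0).
  by rewrite dot0r ltxx.
by rewrite linearB /= uv subrr.
Qed.

Lemma isometric_comp w w' :
  isometric w -> isometric w' -> isometric (w \o w')%VF.
Proof. by move=> iw iw' u v; rewrite !comp_lfunE iw. Qed.

Lemma isometric_coroot w a : isometric w -> w (coroot dot a) = coroot dot (w a).
Proof. by move=> iw; rewrite /coroot linearZ iw. Qed.

Lemma isometric_cor w a v : isometric w -> cor (w a) (w v) = cor a v.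
Proof. by move=> iw; rewrite -isometric_coroot // iw. Qed.

Lemma isometric_refl w a v : isometric w -> w (refl a v) = refl (w a) (w v).
Proof. by move=> iw; rewrite !reflectionE linearB linearZ isometric_cor. Qed.

End InnerProduct.

(** * Positive roots, simple reflections and the Weyl group *)

Section RootSystems.
Variables (R : realType) (V : vectType R) (dot : {dot V for idfun}).
Variables (Delta : {fset V}) (r : nat) (Psi : r.-tuple V).
Hypothesis rootD : is_reduced_root_system dot Delta.
Hypothesis fundP : is_fundamental_system Delta Psi.
Implicit Types (a b u v : V) (w : 'End(V)) (l : seq 'I_r).

Local Notation cor a v := (dot (coroot dot a) v).
Local Notation refl := (reflection dot).
Local Notation pos := (pos_roots Delta Psi).
Local Notation W := (Weyl dot Delta).
Local Notation alpha := (tnth Psi).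

Let basisP : basis_of fullv Psi. Proof. by case: fundP. Qed.

Lemma root_neq0 a : a \in Delta -> a != 0.
Proof. by case: rootD => D0 _ _ _ _ aD; apply: contraNneq D0 => <-. Qed.

Lemma refl_root a b : a \in Delta -> b \in Delta -> refl a b \in Delta.
Proof. by case: rootD => _ _ + _ _; apply. Qed.

Lemma rootN a : a \in Delta -> - a \in Delta.
Proof. by move=> aD; rewrite -(refl_self dot (root_neq0 aD)) refl_root. Qed.

Lemma posE a : (a \in pos) = (a \in Delta) && [forall i, 0 <= coord Psi i a].
Proof. by rewrite in_fset /= inE. Qed.

Lemma pos_root a : a \in pos -> a \in Delta.
Proof. by rewrite posE => /andP[]. Qed.

Lemma pos_coord a i : a \in pos -> 0 <= coord Psi i a.
Proof. by rewrite posE => /andP[_ /forallP]. Qed.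

Lemma pos_neq0 a : a \in pos -> a != 0.
Proof. by move/pos_root/root_neq0. Qed.

Lemma coord_simple v : v = \sum_i coord Psi i v *: alpha i.
Proof.
rewrite {1}(coord_basis basisP (memvf v)).
by apply: eq_bigr => i _; rewrite (tnth_nth 0).
Qed.

Lemma coord_alpha i j : coord Psi i (alpha j) = (i == j)%:R.
Proof. by rewrite (tnth_nth 0) coord_free ?(basis_free basisP) // eq_sym. Qed.

Lemma posVneg a : a \in Delta -> (a \in pos) || (- a \in pos).
Proof.
move=> aD; have [_ _ /(_ _ aD) [h|h]] := fundP; rewrite !posE rootN aD //=.
  by apply/orP; left; apply/forallP => i; exact: natr_ge0 (h i).
by apply/orP; right; apply/forallP => i; rewrite linearN; exact: natr_ge0 (h i).
Qed.

Lemma posN a : a \in pos -> - a \notin pos.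
Proof.
move=> ap; apply/negP => nap; have := pos_neq0 ap; rewrite (coord_simple a) big1 ?eqxx //.
move=> i _; suff -> : coord Psi i a = 0 by rewrite scale0r.
have := pos_coord i ap; have := pos_coord i nap; rewrite linearN /= oppr_ge0.
by move=> h1 h2; apply/eqP; rewrite eq_le h1.
Qed.

Lemma posNE a : a \in Delta -> (- a \in pos) = (a \notin pos).
Proof.
move=> aD; have := posVneg aD; case: (boolP (a \in pos)) => //= /posN ap _.
exact: negbTE.
Qed.

Lemma alpha_pos i : alpha i \in pos.
Proof.
rewrite posE; have [_ -> _] := fundP; apply/forallP => j.
by rewrite coord_alpha ler0n.
Qed.

Lemma alpha_root i : alpha i \in Delta. Proof. exact/pos_root/alpha_pos. Qed.

Lemma alpha_neq0 i : alpha i != 0. Proof. exact/root_neq0/alpha_root. Qed.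

(** The reflection changes only the coordinate at [i]. If the image were negative, all other
    coordinates of [a] would vanish, and reducedness would force [a] to be [alpha i]. *)
Lemma refl_alpha_pos i a : a \in pos -> a != alpha i -> refl (alpha i) a \in pos.
Proof.
move=> ap ai; set b := refl _ a.
have bD : b \in Delta by rewrite refl_root ?alpha_root ?pos_root.
apply: contraR ai; rewrite -posNE // => nb.
have cj j : j != i -> coord Psi j a = 0.
  move=> ji; apply/eqP; rewrite eq_le (pos_coord j ap) andbT.
  have := pos_coord j nb; rewrite linearN oppr_ge0 /b reflectionE.
  by rewrite linearB linearZ /= coord_alpha (negPf ji) mulr0 subr0.
have ea : a = coord Psi i a *: alpha i.
  rewrite {1}(coord_simple a) (bigD1 i) //= big1 ?addr0 // => j ji.
  by rewrite cj // scale0r.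
have [_ _ _ _ /(_ _ (coord Psi i a) (alpha_root i))] := rootD.
rewrite -ea => /(_ (pos_root ap)) [] e; first by rewrite ea e scale1r.
by have := pos_coord i ap; rewrite e oppr_ge0 ler10.
Qed.

Lemma Weyl_isometric w : W w -> isometric dot w.
Proof.
elim=> [u v|a {}w aD _ iw]; first by rewrite !id_lfunE.
by apply: isometric_comp => //; apply/refl_isometric/root_neq0.
Qed.

Lemma Weyl_lker w : W w -> lker w == 0%VS.
Proof. by move/Weyl_isometric/isometric_lker. Qed.

Lemma Weyl_root w a : W w -> a \in Delta -> w a \in Delta.
Proof.
move=> Ww; elim: Ww a => [a|b {}w bD _ IHw a aD]; first by rewrite id_lfunE.
by rewrite comp_lfunE refl_root // IHw.
Qed.

Lemma Weyl_refl1 a : a \in Delta -> W (refl a).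
Proof. by move=> aD; rewrite -[refl a]comp_lfun1r; apply: Weyl_refl aD (Weyl_id _ _). Qed.

Lemma Weyl_comp w w' : W w -> W w' -> W (w \o w')%VF.
Proof.
elim=> [|a {}w aD _ IHw] Ww'; first by rewrite comp_lfun1l.
by rewrite -comp_lfunA; apply: Weyl_refl (IHw _).
Qed.

Lemma Weyl_inv w : W w -> W (w^-1)%VF.
Proof.
elim=> [|a {}w aD Ww IHw].
  rewrite (_ : _^-1%VF = \1%VF); first exact: Weyl_id.
  apply/lfunP => v; have k : lker (\1%VF : 'End(V)) == 0%VS.
    exact/Weyl_lker/Weyl_id.
  by rewrite -{1}[v]id_lfunE lker0_lfunK // id_lfunE.
rewrite (_ : _^-1%VF = (w^-1 \o refl a)%VF).
  exact/Weyl_comp/Weyl_refl1.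
apply/lfunP => v; have k : lker (refl a \o w)%VF == 0%VS.
  exact/Weyl_lker/Weyl_refl.
apply: (lker0P k); rewrite lker0_lfunVK // !comp_lfunE lker0_lfunVK ?Weyl_lker //.
by rewrite reflK // root_neq0.
Qed.

(** [Weyl] is generated by all reflections; words in the simple ones carry a length on which to
    induct. *)
Fixpoint word l : 'End(V) :=
  if l is i :: l' then (refl (alpha i) \o word l')%VF else \1%VF.

Lemma word_Weyl l : W (word l).
Proof.
elim: l => [|i l IHl] /=; [exact: Weyl_id | exact: Weyl_refl (alpha_root i) _].
Qed.

Lemma word_cat l l' v : word (l ++ l') v = word l (word l' v).
Proof.
elim: l => [|i l IHl] /=; first by rewrite id_lfunE.
by rewrite !comp_lfunE IHl.
Qed.

(** Apply the letters to [alpha i] from right to left. The letter [j] at which the root first turns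
    negative must meet [alpha j] itself, so the part of the word to its right conjugates the
    reflection at [i] into that at [j], and letter [j] is deleted. *)
Lemma exchange l i : word l (alpha i) \notin pos ->
  exists2 l', size l = (size l').+1 & (word l \o refl (alpha i))%VF = word l'.
Proof.
elim: l => [|j l IHl] /=; first by rewrite id_lfunE alpha_pos.
rewrite comp_lfunE => neg.
have [p|/IHl [l' sl e]] := boolP (word l (alpha i) \in pos); last first.
  by exists (j :: l'); rewrite /= ?sl // -e comp_lfunA.
have e : word l (alpha i) = alpha j.
  by apply: contraNeq neg; exact: refl_alpha_pos.
exists l => //; apply/lfunP => v; rewrite !comp_lfunE.
rewrite (isometric_refl _ _ (Weyl_isometric (word_Weyl l))) e.
by rewrite reflK // alpha_neq0.
Qed.

(** If the last letter is [i], the preceding letters send [alpha i] to a negative root. By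
    [exchange] the word can be shortened by two letters, and induction on the length applies. *)
Lemma word_pos_id l : (forall a, a \in pos -> word l a \in pos) -> word l = \1%VF.
Proof.
have [n] := ubnP (size l); elim: n l => // n IHn l.
case/lastP: l => [//|l i]; rewrite size_rcons !ltnS => sl lpos.
have wE v : word (rcons l i) v = word l (refl (alpha i) v).
  by rewrite -cats1 word_cat /= comp_lfunE id_lfunE.
have [l' sl' e] : exists2 l', size l = (size l').+1 &
    (word l \o refl (alpha i))%VF = word l'.
  apply: exchange; have := lpos _ (alpha_pos i).
  rewrite wE refl_self ?alpha_neq0 // linearN => /posN; by rewrite opprK.
have we : word (rcons l i) = word l'.
  by apply/lfunP => v; rewrite wE -e comp_lfunE.
rewrite we; apply: IHn; first by rewrite (leq_trans _ sl) // sl' ltnS.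
by move=> a; rewrite -we; exact: lpos.
Qed.

(** Induction on the height of a positive root: if [a] is not simple, some simple reflection takes
    it to a positive root [b] of smaller height, and the reflection in [a] is conjugate to that in
    [b]. *)
Lemma refl_word a : a \in Delta -> exists l, refl a = word l.
Proof.
wlog ap : a / a \in pos.
  move=> H aD; have := posVneg aD => /orP[/H|/H]; first exact.
  by rewrite reflN; apply; exact: rootN.
move=> _; pose ht a := \sum_i coord Psi i a.
have ht0 b : b \in pos -> 0 <= ht b by move=> bp; apply: sumr_ge0 => i _; exact: pos_coord.
(* Heights are real numbers here, so the induction runs on a natural number above the height. *)
have := archi_boundP (ht0 _ ap); move: (Num.bound _) => n.
elim: n a ap => [|n IHn] a ap; first by rewrite ltNge ht0.
move=> han; have := dot_gt0 dot (pos_neq0 ap).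
(* Expanding the positive number <a, a> in simple roots exhibits an [alpha i] with <alpha i, a> >
   0. *)
rewrite {2}(coord_simple a) dot_sumr => s0.
have [i ip] : exists i, 0 < dot a (coord Psi i a *: alpha i).
  apply/existsP; apply: contraTT s0; rewrite negb_exists => /forallP H.
  by rewrite -leNgt sumr_le0 // => i _; rewrite leNgt H.
have {}ip : 0 < dot (alpha i) a.
  rewrite dotC; rewrite dotZr in ip; have := pos_coord i ap.
  rewrite le_eqVlt => /orP[/eqP c0|c0]; first by rewrite -c0 mul0r ltxx in ip.
  by rewrite pmulr_rgt0 in ip.
have [->|ai] := eqVneq a (alpha i).
  by exists [:: i]; rewrite /= comp_lfun1r.
have bp := refl_alpha_pos ap ai; set b := refl _ a in bp.
(* The height drops by the pairing of [a] with the coroot of [alpha i], a positive integer and hence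
   at least 1. *)
have hb : ht b < n%:R.
  have c1 : 1 <= cor (alpha i) a.
    have ci : cor (alpha i) a \is a Num.int.
      by have [_ _ _ + _] := rootD; apply; rewrite ?alpha_root ?pos_root.
    have /intrP[m em] := ci; rewrite -(cor_gt0 dot _ (alpha_neq0 i)) em ltr0z in ip.
    by rewrite em ler1z -gtz0_ge1.
  have -> : ht b = ht a - cor (alpha i) a.
    rewrite /ht; under eq_bigr do rewrite /b reflectionE linearB linearZ /= coord_alpha.
    rewrite sumrB; congr (_ - _); rewrite (bigD1 i) //= eqxx mulr1 big1 ?addr0 // => j ji.
    by rewrite (negPf ji) mulr0.
  by move: han; rewrite -addn1 natrD; lra.
have [l e] := IHn _ bp hb; exists (i :: l ++ [:: i]).
have ab : a = refl (alpha i) b by rewrite reflK ?alpha_neq0.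
apply/lfunP => v; rewrite /= comp_lfunE word_cat /= comp_lfun1r -e.
rewrite isometric_refl; last exact/refl_isometric/alpha_neq0.
by rewrite -ab reflK ?alpha_neq0.
Qed.

Lemma Weyl_word w : W w -> exists l, w = word l.
Proof.
elim=> [|a {}w aD _ [l ->]]; first by exists [::].
have [l' ->] := refl_word aD; exists (l' ++ l).
by apply/lfunP => v; rewrite word_cat comp_lfunE.
Qed.

Lemma Weyl_pos_id w : W w -> (forall a, a \in pos -> w a \in pos) -> w = \1%VF.
Proof. by move=> /Weyl_word [l ->]; exact: word_pos_id. Qed.

(** A Weyl element is determined by the images of the simple roots, which lie in the finite set
    [Delta]; [g] recovers the element from them. *)
Lemma Weyl_finite : finite_set W.
Proof.
pose g (t : {ffun 'I_r -> Delta}) : 'End(V) :=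
  xget 0 [set w | W w /\ forall i, w (alpha i) = val (t i)].
apply: (@sub_finite_set _ _ (range g)); last exact: finite_image.
move=> w Ww; exists [ffun i => [` Weyl_root Ww (alpha_root i)]%fset] => //.
rewrite /g; case: xgetP => [w' _ /= [Ww' e]|/(_ w) []]; last first.
  by split=> // i; rewrite ffunE.
apply/lfunP => v; rewrite (coord_simple v) !linear_sum; apply: eq_bigr => i _.
by rewrite !linearZ /= e ffunE.
Qed.

(** * Weights and Weyl chambers *)

Variable lam : r.-tuple V.
Hypothesis dimV : \dim {:V} = r.
Hypothesis lamP : are_fundamental_weights dot Psi lam.

Local Notation P := (weights lam).
Local Notation Pdom := (strictly_dominant_weights lam).
Local Notation H := (walls dot Delta).

Lemma cor_sum_lam (k : 'I_r -> R) j :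
  cor (alpha j) (\sum_i k i *: tnth lam i) = k j.
Proof.
rewrite dot_sumr (bigD1 j) //= dotZr lamP eqxx mulr1 big1 ?addr0 // => i ij.
by rewrite dotZr lamP eq_sym (negPf ij) mulr0.
Qed.

(** Duality with the simple coroots gives independence, and the dimension gives spanning. *)
Lemma lam_basis : basis_of fullv lam.
Proof.
rewrite basisEfree subvf size_tuple dimV leqnn !andbT.
apply/freeP => k k0 i; rewrite -(cor_sum_lam k i).
under eq_bigr do rewrite (tnth_nth 0).
by rewrite k0 dot0r.
Qed.

Lemma lam_expansion v : v = \sum_i cor (alpha i) v *: tnth lam i.
Proof.
have e : v = \sum_i coord lam i v *: tnth lam i.
  rewrite {1}(coord_basis lam_basis (memvf v)).
  by apply: eq_bigr => i _; rewrite (tnth_nth 0).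
by rewrite {1}e; apply: eq_bigr => i _; rewrite [in RHS]e cor_sum_lam.
Qed.

Lemma coord_lam i v : coord lam i v = cor (alpha i) v.
Proof.
rewrite {1}(lam_expansion v).
under eq_bigr do rewrite (tnth_nth 0 lam).
by rewrite coord_sum_free // (basis_free lam_basis).
Qed.

Lemma cor_alpha_inj u v : (forall i, cor (alpha i) u = cor (alpha i) v) -> u = v.
Proof.
move=> e; rewrite (lam_expansion u) (lam_expansion v).
by apply: eq_bigr => i _; rewrite e.
Qed.

Lemma weightsP v : P v <-> forall j, cor (alpha j) v \is a Num.int.
Proof.
split=> [[m ->] j|h]; first by rewrite cor_sum_lam; exact: intr_int.
exists (fun j => Num.floor (cor (alpha j) v)).
rewrite {1}(lam_expansion v); apply: eq_bigr => j _.
by congr (_ *: _); apply/esym/eqP; rewrite -intrEfloor h.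
Qed.

Lemma PdomP v :
  Pdom v <-> forall j, exists2 m : nat, (0 < m)%N & cor (alpha j) v = m%:R.
Proof.
split=> [[m [m0 ->]] j|h]; first by exists (m j); rewrite ?cor_sum_lam.
have [m hm] : {m : 'I_r -> nat & forall j, (0 < m j)%N /\ cor (alpha j) v = (m j)%:R}.
  exists (fun j => xget 0%N [set m | (0 < m)%N /\ cor (alpha j) v = m%:R]) => j.
  apply: (@xgetPex _ _ [set m | (0 < m)%N /\ cor (alpha j) v = m%:R]).
  by have [m m0 e] := h j; exists m.
exists m; split=> [j|]; first by case: (hm j).
by rewrite {1}(lam_expansion v); apply: eq_bigr => j _; case: (hm j) => _ ->.
Qed.

Lemma Pdom_weight v : Pdom v -> P v.
Proof.
move=> /PdomP h; apply/weightsP => j; have [m _ ->] := h j; exact: intr_nat.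
Qed.

Lemma Pdom_alpha v j : Pdom v -> 0 < cor (alpha j) v.
Proof. by move=> /PdomP /(_ j) [m m0 ->]; rewrite ltr0n. Qed.

Lemma Pdom_intro v : P v -> (forall j, 0 < cor (alpha j) v) -> Pdom v.
Proof.
move=> /weightsP h v0; apply/PdomP => j; have /intrP[m em] := h j.
have := v0 j; rewrite em ltr0z; by case: m em => // m _ m0; exists m.
Qed.

(** Expand <a, v> in the simple roots occurring in [a]. The predicate [Q] is all indices when [v] is
    dominant, and [I] when only the pairings at [I] are controlled. *)
Lemma cor_pos_ge0 a v (Q : pred 'I_r) : a \in pos ->
  (forall i, ~~ Q i -> coord Psi i a = 0) ->
  (forall i, Q i -> 0 <= cor (alpha i) v) -> 0 <= cor a v.
Proof.
move=> ap ca h; rewrite corE mulr_ge0 //.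
  by rewrite divr_ge0 // ltW // dot_gt0 // pos_neq0.
rewrite dotC {1}(coord_simple a) dot_sumr sumr_ge0 // => i _.
rewrite dotZr; case: (boolP (Q i)) => [Qi|/ca ->]; last by rewrite mul0r.
rewrite mulr_ge0 ?pos_coord // dotC; have := h i Qi.
by rewrite corE pmulr_rge0 // divr_gt0 // dot_gt0 // alpha_neq0.
Qed.

(** A vanishing sum of nonnegative terms would make every coordinate of [a] zero. *)
Lemma cor_pos_gt0 a v : a \in pos -> (forall i, 0 < cor (alpha i) v) -> 0 < cor a v.
Proof.
move=> ap h; rewrite lt_neqAle (@cor_pos_ge0 _ _ predT) // ?andbT; last first.
  by move=> i _; exact/ltW.
apply: contraTneq ap => /esym c0; apply/negP => ap.
have := pos_neq0 ap; rewrite (coord_simple a) big1 ?eqxx // => i _.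
have di j : 0 < dot v (alpha j) by rewrite dotC -(cor_gt0 dot _ (alpha_neq0 j)).
move: c0; rewrite corE => /eqP; rewrite mulf_eq0 gt_eqF /=; last first.
  by rewrite divr_gt0 // dot_gt0 // pos_neq0.
rewrite dotC {1}(coord_simple a) dot_sumr => /eqP s0.
have t0 j : true -> 0 <= dot v (coord Psi j a *: alpha j).
  by move=> _; rewrite dotZr mulr_ge0 ?pos_coord // ltW.
have /eqP := psumr_eq0P t0 s0 (i := i) isT.
by rewrite dotZr mulf_eq0 (gt_eqF (di i)) orbF => /eqP ->; rewrite scale0r.
Qed.

Lemma Pdom_pos a v : a \in pos -> Pdom v -> 0 < cor a v.
Proof. by move=> ap vd; apply: cor_pos_gt0 => // i; exact: Pdom_alpha. Qed.

Lemma Pdom_not_wall v : Pdom v -> ~ H v.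
Proof.
move=> vd [a aD c0]; have /orP[ap|ap] := posVneg aD.
  by have := Pdom_pos ap vd; rewrite c0 ltxx.
by have := Pdom_pos ap vd; rewrite corN c0 oppr0 ltxx.
Qed.

(** A simple reflection changes each pairing by the product of an integral pairing of [v] and a
    Cartan integer. *)
Lemma Weyl_weight w v : W w -> P v -> P (w v).
Proof.
move=> /Weyl_word [l ->]; elim: l v => [|i l IHl] v Pv /=; first by rewrite id_lfunE.
rewrite comp_lfunE; have /weightsP h := IHl _ Pv; apply/weightsP => j.
rewrite reflectionE dotDr dotNr dotZr rpredB ?h // rpredM ?h //.
by have [_ _ _ + _] := rootD; apply; exact: alpha_root.
Qed.

Lemma Weyl_not_wall w v : W w -> ~ H v -> ~ H (w v).
Proof.
move=> Ww nH [a aD c0]; apply: nH; exists (w^-1%VF a); first exact/Weyl_root/aD/Weyl_inv.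
by rewrite -(isometric_cor _ _ (Weyl_isometric Ww)) lker0_lfunVK // Weyl_lker.
Qed.

(* Each simple reflection in a wall separating [v] from the dominant chamber
   decreases the number of positive coroots that are negative on [v]. *)
Lemma chamber_exists v : P v -> ~ H v -> exists w u, [/\ W w, Pdom u & v = w u].
Proof.
pose N v := [fset a in pos | cor a v < 0]%fset.
have NE u a : (a \in N u) = (a \in pos) && (cor a u < 0) by rewrite in_fset /= inE.
have [n] := ubnP #|` N v|; elim: n v => // n IHn v; rewrite ltnS => Nv Pv nH.
have [/forallP vd|] := boolP [forall j, 0 < cor (alpha j) v].
  by exists \1%VF, v; split; rewrite ?id_lfunE //; [exact: Weyl_id | exact: Pdom_intro].
case/forallPn => i; rewrite -leNgt le_eqVlt => /orP[/eqP c0|c0].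
  by case: nH; exists (alpha i) => //; exact: alpha_root.
have Wi := Weyl_refl1 (alpha_root i).
have [|||w [u [Ww ud e]]] := IHn (refl (alpha i) v).
(* The reflection embeds the set for the reflected weight into [N v] without [alpha i], which does
   belong to [N v]. *)
- apply: leq_trans Nv; apply: (@leq_ltn_trans #|` (N v `\ alpha i)%fset|); last first.
    rewrite [X in (_ < X)%N](cardfsD1 (alpha i)) -[X in (X < _)%N]add0n ltn_add2r.
    by rewrite NE c0 alpha_pos.
  have <- : #|` [fset refl (alpha i) a | a in N (refl (alpha i) v)]%fset| =
      #|` N (refl (alpha i) v)|.
    by rewrite card_imfset //; exact: can_inj (reflK dot (alpha_neq0 i)).
  apply/fsubset_leq_card/fsubsetP => _ /imfsetP[a /= + ->].
  rewrite in_fsetD1 !NE => /andP[ap ca].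
  have ai : a != alpha i.
    by apply: contraTneq ca => ->; rewrite cor_refl ?alpha_neq0 // -leNgt oppr_ge0 ltW.
  rewrite refl_alpha_pos //= -(isometric_cor _ _ (Weyl_isometric Wi)).
  rewrite reflK ?alpha_neq0 // ca andbT.
  apply: contraTneq ap => e; rewrite -(reflK dot (alpha_neq0 i) a) e.
  by rewrite refl_self ?alpha_neq0 // posN ?alpha_pos.
- exact: Weyl_weight.
- exact: Weyl_not_wall.
exists (refl (alpha i) \o w)%VF, u; split=> //; first exact: Weyl_comp.
by rewrite comp_lfunE -e reflK ?alpha_neq0.
Qed.

(** The element w'^-1 w takes [u] to [u']. Since both are strictly dominant, comparing pairings
    shows that it preserves positive roots, so it is the identity. *)
Lemma chamber_unique w w' u u' :
  W w -> W w' -> Pdom u -> Pdom u' -> w u = w' u' -> w = w'.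
Proof.
move=> Ww Ww' ud ud' e; have kw' := Weyl_lker Ww'.
suff e1 : (w'^-1 \o w)%VF = \1%VF.
  by rewrite -[w](lker0_compVKf kw') e1 comp_lfun1r.
have Wg : W (w'^-1 \o w)%VF by apply: Weyl_comp => //; exact: Weyl_inv.
have gu : (w'^-1 \o w)%VF u = u' by rewrite comp_lfunE e lker0_lfunK.
apply: Weyl_pos_id => // a ap.
have gD := Weyl_root Wg (pos_root ap); rewrite -[_ \in _]negbK -posNE //.
apply/negP => /Pdom_pos /(_ ud'); rewrite corN -gu isometric_cor.
  by rewrite oppr_gt0 ltNge ltW // Pdom_pos.
exact: Weyl_isometric.
Qed.

(** * The set W^I and the region of summation *)

Variable I : {set 'I_r}.
Local Notation WI := (W_I dot Delta Psi I).
Local Notation posI := (pos_roots_I Delta Psi I).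

Lemma posI_E a : (a \in posI) = (a \in pos) && (a \in V_I Psi I).
Proof.
by rewrite in_fsetI in_fset /= inE posE; case: (a \in Delta); rewrite // andbC.
Qed.

Lemma posI_coord a i : a \in posI -> i \notin I -> coord Psi i a = 0.
Proof.
rewrite posI_E => /andP[_ /memv_sumP[c cP ->]] iI.
rewrite linear_sum big1 // => j jI; have /vlineP[k ->] := cP j jI.
rewrite linearZ /= coord_alpha; case: eqP => [e|]; last by rewrite mulr0.
by rewrite e jI in iI.
Qed.

Lemma alpha_posI i : i \in I -> alpha i \in posI.
Proof.
move=> iI; rewrite posI_E alpha_pos /=; apply/memv_sumP.
exists (fun j => if j == i then alpha i else 0) => [j _|].
  by case: eqP => [->|_]; [exact: memv_line | exact: mem0v].
by rewrite -big_mkcondr (big_pred1 i) // => j /=; case: eqP => [->|]; rewrite ?iI ?andbF.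
Qed.

(** Passes from coroots to roots: [coroot] is an involution on nonzero vectors and commutes with
    isometries. *)
Lemma WIP w : WI w <-> W w /\ forall a, a \in posI -> (w^-1)%VF a \in pos.
Proof.
split=> [[Ww /fsubsetP h]|[Ww h]]; split=> //; have kw := Weyl_lker Ww;
  have iw := Weyl_isometric Ww.
  move=> a aI; have /h : coroot dot a \in [fset coroot dot a | a in posI]%fset.
    by apply/imfsetP; exists a.
  case/imfsetP => _ /imfsetP[b bp ->]; rewrite isometric_coroot // => e.
  have a0 : a != 0 by move: aI; rewrite posI_E => /andP[/pos_neq0].
  have wb0 : w b != 0 by apply/root_neq0/Weyl_root => //; exact: pos_root.
  by rewrite -(corootK dot a0) e corootK // lker0_lfunK.
apply/fsubsetP => _ /imfsetP[a /= aI ->]; apply/imfsetP.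
exists (coroot dot (w^-1%VF a)).
  by apply/imfsetP; exists (w^-1%VF a) => //; exact: h.
by rewrite isometric_coroot // lker0_lfunVK.
Qed.

Lemma iota_P v : P v ->
  P_Iplus lam I (iota_star lam I v) <-> forall i, i \in I -> 0 <= cor (alpha i) v.
Proof.
move=> Pv; split=> [[m e] i iI|h].
  have : cor (alpha i) (iota_star lam I v) = cor (alpha i) v.
    rewrite /iota_star big_mkcond /=.
    have -> : \sum_i0 (if i0 \in I then coord lam i0 v *: tnth lam i0 else 0) =
       \sum_i0 (if i0 \in I then coord lam i0 v else 0) *: tnth lam i0.
      by apply: eq_bigr => j _; case: ifP => // _; rewrite scale0r.
    by rewrite cor_sum_lam iI coord_lam.
  move=> <-; rewrite e big_mkcond /=.
  have -> : \sum_i0 (if i0 \in I then (m i0)%:R *: tnth lam i0 else 0) =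
       \sum_i0 (if i0 \in I then (m i0)%:R else 0) *: tnth lam i0.
    by apply: eq_bigr => j _; case: ifP => // _; rewrite scale0r.
  by rewrite cor_sum_lam iI ler0n.
(* Truncation is exact at the indices in [I], where the pairing is a nonnegative integer. *)
exists (fun i => Num.truncn (cor (alpha i) v)); apply: eq_bigr => i iI.
rewrite coord_lam; congr (_ *: _); apply/esym/eqP.
by rewrite -natrEtruncn -intrEge0 ?h //; move/weightsP: Pv; apply.
Qed.

(** If v = w u with [u] strictly dominant, the pairing of [v] with the coroot of [a] has the sign of
    the root w^-1 a. *)
Lemma region_decomposition v :
  ((P `&` iota_star lam I @^-1` P_Iplus lam I) `\` H) v <->
  exists w u, [/\ WI w, Pdom u & v = w u].
Proof.
split=> [[[Pv iv] nH]|[w [u [/WIP[Ww wI] ud ->]]]].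
  have [w [u [Ww ud e]]] := chamber_exists Pv nH; exists w, u; split=> //.
  apply/WIP; split=> // a aI.
  have Wi := Weyl_inv Ww; have ap : a \in pos by move: aI; rewrite posI_E => /andP[].
  have aD := pos_root ap; rewrite -[_ \in _]negbK -posNE ?Weyl_root //.
  apply/negP => /Pdom_pos /(_ ud); rewrite corN oppr_gt0 ltNge.
  have -> : u = (w^-1)%VF v by rewrite e lker0_lfunK ?Weyl_lker.
  rewrite isometric_cor; last exact: Weyl_isometric.
  suff -> : 0 <= cor a v by [].
  apply: (cor_pos_ge0 (Q := mem I)) => // i; first exact: posI_coord.
  by move/iota_P: iv; apply.
have Pu := Weyl_weight Ww (Pdom_weight ud).
split; last exact/Weyl_not_wall/Pdom_not_wall.
split=> //; apply/iota_P => // i iI; have kw := Weyl_lker Ww.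
rewrite -[alpha i](lker0_lfunVK kw) isometric_cor; last exact: Weyl_isometric.
by apply/ltW/Pdom_pos/ud/wI/alpha_posI.
Qed.

(** * The zeta-function on the chambers *)

Implicit Types (s : V -> R[i]) (y : V).

Local Notation Dw w := (Delta_ Delta Psi w).
Local Notation acts w s := (act Delta Psi w s).
Local Notation smd s y v := (summand dot Delta Psi s y v).
Local Notation reg := (abs_conv_region Delta Psi).

(** Both [Delta_] and [act] invert their argument, so a double inverse appears when they are taken
    at w^-1. *)
Lemma lfun_invK w : lker w == 0%VS -> (w^-1^-1)%VF = w.
Proof.
move=> kw; apply/lfunP => v.
have kv : lker (w^-1)%VF == 0%VS.
  by apply/lker0P => a b e; rewrite -[a](lker0_lfunVK kw) e lker0_lfunVK.
by rewrite -{1}[v](lker0_lfunK kw) (lker0_lfunK kv).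
Qed.

Lemma neg_rootsE a : (a \in neg_roots Delta Psi) = (- a \in pos).
Proof.
apply/imfsetP/idP => [[b /= bp ->]|ap]; first by rewrite opprK.
by exists (- a); rewrite ?opprK.
Qed.

Lemma Delta_E w a : W w -> (a \in Dw (w^-1)%VF) = (a \in pos) && (- (w^-1)%VF a \in pos).
Proof.
move=> Ww; have kw := Weyl_lker Ww; rewrite in_fsetI lfun_invK //; congr (_ && _).
apply/imfsetP/idP => [[b /= bn ->]|ap]; first by rewrite lker0_lfunK // -neg_rootsE.
by exists (w^-1%VF a); rewrite ?lker0_lfunVK //= neg_rootsE.
Qed.

(** The action of [w] on roots up to sign, with [pos] as representatives; it permutes the factors of
    a summand. *)
Definition abs_root w a : V := if w a \in pos then w a else - w a.

Lemma abs_root_pos w a : W w -> a \in pos -> abs_root w a \in pos.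
Proof.
move=> Ww ap; rewrite /abs_root; case: ifPn => // nwa.
by rewrite posNE // Weyl_root // pos_root.
Qed.

Lemma abs_root_inj w : W w -> {in pos &, injective (abs_root w)}.
Proof.
move=> Ww; have kw := Weyl_lker Ww; have iw := lker0P kw.
move=> a b ap bp; rewrite /abs_root.
case: ifP => _; case: ifP => _; rewrite -?linearN => /iw e //.
- by have := posN bp; rewrite -e ap.
- by have := posN ap; rewrite e bp.
- exact: oppr_inj.
Qed.

Lemma abs_root_surj w : W w -> [fset abs_root w a | a in pos]%fset = pos.
Proof.
move=> Ww; apply/eqP; rewrite eqEfcard; apply/andP; split.
  by apply/fsubsetP => _ /imfsetP[a /= ap ->]; exact: abs_root_pos.
rewrite [X in (_ <= X)%N]card_in_imfset ?leqnn //; exact: abs_root_inj.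
Qed.

Lemma reindex_pos w (F : V -> R[i]) : W w ->
  \prod_(a <- pos) F a = \prod_(a <- pos) F (abs_root w a).
Proof.
by move=> Ww; rewrite -{1}(abs_root_surj Ww) big_imfset //=; exact: abs_root_inj.
Qed.

(** For b = [abs_root w a], membership in the index set on the left means that [w a] is negative. In
    this form the signs can be merged with the factors of a summand. *)
Lemma prod_Delta_ w (F : V -> R[i]) : W w ->
  \prod_(b <- Dw (w^-1)%VF) F b =
  \prod_(a <- pos) (if w a \in pos then 1 else F (abs_root w a)).
Proof.
move=> Ww; have kw := Weyl_lker Ww.
have -> : Dw (w^-1)%VF = [fset b in pos | - (w^-1)%VF b \in pos]%fset.
  by apply/fsetP => b; rewrite [RHS]in_fset /= [RHS]inE Delta_E.
rewrite -big_fset_condE big_mkcond /= (reindex_pos _ Ww).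
rewrite big_seq [RHS]big_seq; apply: eq_bigr => a ap; rewrite {1}/abs_root.
case wa : (w a \in pos); first by rewrite lker0_lfunK // (negPf (posN ap)).
have -> : - w a = w (- a) by rewrite linearN.
by rewrite lker0_lfunK // opprK ap.
Qed.

Lemma act_inv w s a : W w -> acts (w^-1)%VF s a = s (abs_root w a).
Proof.
by move=> Ww; rewrite /act /extend lfun_invK ?Weyl_lker // /abs_root; case: ifP.
Qed.

(** The factor at [abs_root w a] becomes the factor at [a], with a sign when [w a] is negative. The
    sign rule is a hypothesis because it is met in two ways: by dominance of [u], or by integrality
    of the exponents. *)
Lemma summand_Weyl w s y u : W w ->
  (forall a, a \in pos -> w a \notin pos ->
    cpow (- cor a u) (s (- w a)) = cpow (cor a u) (s (- w a)) * cpow (-1) (s (- w a))) ->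
  smd s y (w u) =
  (\prod_(b <- Dw (w^-1)%VF) cpow (-1) (s b))^-1 *
  smd (acts (w^-1)%VF s) ((w^-1)%VF y) u.
Proof.
move=> Ww hc; have iw := Weyl_isometric Ww; have kw := Weyl_lker Ww.
rewrite /summand -[in LHS](lker0_lfunVK kw y) iw mulrCA; congr (_ * _).
rewrite prod_Delta_ // (reindex_pos (fun a => (cpow (cor a (w u)) (s a))^-1) Ww).
rewrite -prodfV -big_split /=.
rewrite big_seq [RHS]big_seq; apply: eq_bigr => a ap.
rewrite act_inv // -invfM; congr (_^-1); rewrite /abs_root.
case wa : (w a \in pos); first by rewrite isometric_cor // mul1r.
by rewrite corN isometric_cor // hc ?wa // mulrC.
Qed.

Lemma summand_dominant w s y u : W w -> Pdom u ->
  smd s y (w u) = (\prod_(b <- Dw (w^-1)%VF) cpow (-1) (- s b)) *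
    smd (acts (w^-1)%VF s) ((w^-1)%VF y) u.
Proof.
move=> Ww ud; rewrite summand_Weyl //.
  by rewrite -prodfV; congr (_ * _); apply: eq_bigr => b _; rewrite cpowN1N.
by move=> a ap _; rewrite cpow_opp_pos // Pdom_pos.
Qed.

Lemma act_region w s : W w -> reg s -> reg (acts (w^-1)%VF s).
Proof.
by move=> Ww sr a ap; rewrite act_inv //; apply/sr/abs_root_pos.
Qed.

Lemma prod_simple (F : V -> R) :
  \prod_(a <- pos) F a = (\prod_(a <- pos | a \notin Psi) F a) * \prod_i F (alpha i).
Proof.
rewrite (bigID (fun a => a \in (Psi : seq V))) /= mulrC; congr (_ * _).
rewrite -big_filter -[RHS](big_tuple _ _ _ predT F); apply: perm_big; apply: uniq_perm.
- by rewrite filter_uniq // fset_uniq.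
- exact/free_uniq/(basis_free basisP).
move=> a; rewrite mem_filter; case: (boolP (a \in Psi)) => //= /tnthP[i ->].
exact: alpha_pos.
Qed.

(** The simple roots alone give a convergent product of p-series; the other factors are bounded by
    their values at [rho], collected in [M]. *)
Lemma zeta_summable s y : reg s ->
  has_usum (patch (fun=> 0) Pdom (summand dot Delta Psi s y) : V -> R[i]^o)
    (zeta dot Delta Psi lam s y : R[i]^o).
Proof.
move=> sr; pose rho := \sum_i 1 *: tnth lam i.
pose sg a := complex.Re (s a).
pose h (x c : R) := expR (- (x * ln c)).
pose M := \prod_(a <- pos | a \notin Psi) h (sg a) (cor a rho).
(* The coordinates of a strictly dominant weight start at 1, the indices of the p-series at 0. *)
pose m v i := (Num.truncn (cor (alpha i) v)).-1.
have mE v i : Pdom v -> cor (alpha i) v = (m v i).+1%:R.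
  move=> /PdomP /(_ i) [n n0 e]; rewrite /m e natrK prednK //.
have [||C hC] := @prod_pseries_bound R r V Pdom m (fun i => sg (alpha i)).
- by move=> i; apply/sr/alpha_pos.
- move=> u v ud vd e; apply: cor_alpha_inj => i; by rewrite !mE // e.
pose g v := M * patch (fun=> 0) Pdom (fun v => \prod_i h (sg (alpha i)) (m v i).+1%:R) v.
have M0 : 0 <= M by apply: prodr_ge0 => a _; exact/ltW/expR_gt0.
suff [l hl] : exists l : R[i],
    has_usum (patch (fun=> 0) Pdom (summand dot Delta Psi s y) : V -> R[i]^o)
      (l : R[i]^o).
  by rewrite /zeta /csum (has_usum_unique hl).
apply: (@usum_bounded _ _ _ g (M * C)) => [v|F]; last first.
  by rewrite -mulr_sumr ler_wpM2l.
rewrite /g /patch; case: ifPn => [/set_mem vd|_]; last by rewrite normr0 mulr0.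
rewrite /summand normrM norm_cexp_im mul1r normr_prod.
have e a : a \in pos -> `|(cpow (cor a v) (s a))^-1| = (h (sg a) (cor a v))%:C.
  move=> ap; rewrite normfV norm_cpow_pos ?Pdom_pos // /h expRN.
  by rewrite -(fmorphV (real_complex R)).
rewrite big_seq (eq_bigr _ e) -big_seq -(rmorph_prod (real_complex R)) lecR.
rewrite prod_simple (eq_bigr (fun i => h (sg (alpha i)) (m v i).+1%:R)); last first.
  by move=> i _; rewrite mE.
rewrite ler_wpM2r //; first by apply: prodr_ge0 => i _; exact/ltW/expR_gt0.
rewrite /M big_seq_cond [leRHS]big_seq_cond; apply: ler_prod => a /andP[ap _].
rewrite /h expR_ge0 /= ler_expR lerN2 ler_pM2l; last first.
  exact: lt_trans ltr01 (sr a ap).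
have rd : 0 < cor a rho by apply: cor_pos_gt0 => // i; rewrite cor_sum_lam.
rewrite ler_ln ?posrE ?(Pdom_pos ap vd) //.
(* The difference v - rho is dominant, since the coordinates of [v] are at least 1. *)
rewrite -subr_ge0 -dotNr -dotDr; apply: (cor_pos_ge0 (Q := predT)) => // i _.
by rewrite dotDr dotNr cor_sum_lam mE // subr_ge0 ler1n.
Qed.

Lemma chamber_sum w s y : W w -> reg s ->
  has_usum
   (patch (fun=> 0) [set w u | u in Pdom] (summand dot Delta Psi s y) : V -> R[i]^o)
   ((\prod_(b <- Dw (w^-1)%VF) cpow (-1) (- s b)) *
    zeta dot Delta Psi lam (acts (w^-1)%VF s) ((w^-1)%VF y) : R[i]^o).
Proof.
move=> Ww sr; have kw := Weyl_lker Ww.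
set c := \prod_(b <- _) _.
have := has_usumZ (c := c : R[i]) (zeta_summable (y := (w^-1)%VF y) (act_region Ww sr)).
move/(has_usum_reindex (lker0_lfunVK kw) (lker0_lfunK kw)).
congr has_usum; apply/funext => v; rewrite /= /patch.
have -> : (v \in [set w u | u in Pdom]) = ((w^-1)%VF v \in Pdom).
  apply/idP/idP => /set_mem => [[u ud <-]|vd]; apply/mem_set.
    by rewrite lker0_lfunK.
  by exists ((w^-1)%VF v); rewrite ?lker0_lfunVK.
case: ifPn => [/set_mem vd|_]; last by rewrite scaler0.
by have := summand_dominant s y Ww vd; rewrite lker0_lfunVK // => ->.
Qed.


Lemma region_sum s y : reg s ->
  S_sum dot Delta Psi lam I s y =
  \sum_(w \in WI) ((\prod_(b <- Dw (w^-1)%VF) cpow (-1) (- s b)) *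
    zeta dot Delta Psi lam (acts (w^-1)%VF s) ((w^-1)%VF y)).
Proof.
move=> sr; have WIfin : finite_set WI.
  by apply: sub_finite_set Weyl_finite => w /WIP[].
have inWI w : (w \in fset_set WI) = (w \in WI) by rewrite in_fset_set.
rewrite fsbig_finite //= /S_sum /csum.
set f := fun w => _; set D := _ `\` _.
pose g w := patch (fun=> 0) [set w u | u in Pdom] (summand dot Delta Psi s y).
apply: (has_usum_unique (E := R[i]^o)).
(* The chambers are disjoint by [chamber_unique], so at each point of [D] exactly one term of the
   finite sum is live. *)
have -> : patch (fun=> 0) D (summand dot Delta Psi s y) =
    (fun v => \sum_(w <- fset_set WI) g w v).
  apply/funext => v; rewrite {1}/patch; case: ifPn => [/set_mem|/negP vD].
    case/region_decomposition => w [u [wI ud e]].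
    have wX : w \in fset_set WI by rewrite inWI mem_set.
    rewrite (bigD1_seq w) ?fset_uniq //= {1}/g /patch ifT; last first.
      by apply/mem_set; exists u.
    rewrite big_seq_cond big1 ?addr0 // => w' /andP[].
    rewrite inWI => /set_mem w'I ww'; rewrite /g /patch ifF //.
    apply/negbTE; apply: contraNN ww' => /set_mem[u' u'd e'].
    have [Ww _] := (WIP w).1 wI; have [Ww' _] := (WIP w').1 w'I.
    by apply/eqP; apply: (chamber_unique Ww' Ww u'd ud); rewrite e' e.
  rewrite big_seq big1 // => w; rewrite inWI => /set_mem wI.
  rewrite /g /patch ifF //; apply/negbTE/negP => /set_mem[u ud e]; apply: vD.
  by apply/mem_set/region_decomposition; exists w, u.
apply: (has_usum_sum (E := R[i]^o)) => w.
rewrite inWI => /set_mem /WIP[Ww _].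
exact: chamber_sum.
Qed.

(* [w1] changes the sign of every single summand of [S]. *)
Lemma chamber_sum_odd w1 w s y : W w1 -> W w -> reg s ->
  (forall a, a \in Dw (w1^-1)%VF -> exists m : int, s a = m%:~R) ->
  \prod_(a <- Dw (w1^-1)%VF) cpow (-1) (s a) = -1 ->
  (forall a, a \in pos -> acts (w1^-1)%VF s a = s a) ->
  (w1^-1)%VF y = y ->
  let term (v : 'End(V)) := (\prod_(b <- Dw (v^-1)%VF) cpow (-1) (- s b)) *
    zeta dot Delta Psi lam (acts (v^-1)%VF s) ((v^-1)%VF y) in
  term (w1 \o w)%VF = - term w.
Proof.
move=> Ww1 Ww sr sint odd sinv yinv /=; have kw1 := Weyl_lker Ww1.
have h1 := chamber_sum (y := y) (Weyl_comp Ww1 Ww) sr.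
have h := has_usumZ (c := -1 : R[i]) (chamber_sum (y := y) Ww sr).
have {h} := has_usum_reindex (lker0_lfunVK kw1) (lker0_lfunK kw1) h.
rewrite -[RHS](scaleN1r (_ : R[i]^o)) => h.
apply: etrans (has_usum_unique h); symmetry; apply: etrans (has_usum_unique h1).
(* Both sides are now sums of families on [V]; these agree pointwise. *)
congr summability.sum; apply/funext => v /=; rewrite /patch.
have -> : (v \in [set ((w1 \o w)%VF : 'End(V)) u | u in Pdom]) =
    ((w1^-1 : 'End(V))%VF v \in [set w u | u in Pdom]).
  apply/idP/idP => /set_mem[u ud e]; apply/mem_set; exists u => //.
    by rewrite -e comp_lfunE lker0_lfunK.
  by rewrite comp_lfunE e lker0_lfunVK.
case: ifPn => [/set_mem[u ud e]|_]; last by rewrite scaler0.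
have -> : v = w1 (w u) by rewrite e lker0_lfunVK.
(* The weight [w u] is regular but perhaps not dominant, so the sign rule comes from the integrality
   of the exponents. *)
rewrite lker0_lfunK // (summand_Weyl (w := w1)) //; last first.
  move=> a ap w1a; apply: cpow_opp_int.
    apply/eqP => c0; apply: (Weyl_not_wall Ww (Pdom_not_wall ud)).
    by exists a => //; exact: pos_root.
  apply: sint; rewrite Delta_E // posNE ?Weyl_root ?pos_root // w1a /=.
  have -> : - w1 a = w1 (- a) by rewrite linearN.
  by rewrite lker0_lfunK // opprK.
rewrite odd invrN1 yinv scaleN1r mulN1r /summand; congr (- (_ * _)).
by rewrite big_seq [RHS]big_seq; apply: eq_bigr => a ap; rewrite sinv.
Qed.

End RootSystems.

(** * Cancellation between the chambers paired by w1 *)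

Theorem theorem2p1 (R : realType) (V : vectType R) (dot : {dot V for idfun})
    (r : nat) (Delta : {fset V}) (Psi lam : r.-tuple V) (I : {set 'I_r})
    (w1 : 'End(V)) (s : V -> R[i]) (y : V) :
  \dim {:V} = r ->
  is_reduced_root_system dot Delta ->
  is_fundamental_system Delta Psi ->
  are_fundamental_weights dot Psi lam ->
  I != finset.set0 ->
  AutD Delta w1 ->
  abs_conv_region Delta Psi s ->
  (forall a, a \in Delta_ Delta Psi (w1^-1)%VF -> exists m : int, s a = m%:~R) ->
  \prod_(a <- Delta_ Delta Psi (w1^-1)%VF) cpow (-1) (s a) = -1 ->
  (forall a, a \in pos_roots Delta Psi ->
     act Delta Psi (w1^-1)%VF s a = s a) ->
  (w1^-1)%VF y = y ->
  let WI := W_I dot Delta Psi I in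
  let w1WI := [set (w1 \o v)%VF | v in WI] in
  let w1invWI := [set (w1^-1 \o v)%VF | v in WI] in
  let term (v : 'End(V)) : R[i] :=
    (\prod_(a <- Delta_ Delta Psi (v^-1)%VF) cpow (-1) (- s a)) *
    zeta dot Delta Psi lam (act Delta Psi (v^-1)%VF s) ((v^-1)%VF y) in
  S_sum dot Delta Psi lam I s y =
    2^-1 * (\sum_(v \in WI `\` w1WI) term v + \sum_(v \in WI `\` w1invWI) term v)
  /\ (w1invWI = w1WI ->
      S_sum dot Delta Psi lam I s y = \sum_(v \in WI `\` w1WI) term v).
Proof.
move=> dimV rootD fundP lamP _ [kw1 _] sr sint odd sinv yinv WI w1WI w1invWI term.
have {}kw1 : lker w1 == 0%VS by rewrite kw1.
have -> : S_sum dot Delta Psi lam I s y = \sum_(v \in WI) term v.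
  exact: region_sum.
have WIfin : finite_set WI.
  by apply: sub_finite_set (Weyl_finite rootD fundP) => w [].
have half (x : R[i]) : 2^-1 * (x + x) = x by field.
have [Ww1|nW] := pselect (Weyl dot Delta w1); last first.
  have WD w : ~ Weyl dot Delta w -> WI `\` [set (w \o v)%VF | v in WI] = WI.
    move=> nw; apply/seteqP; split=> [v []//|v vI]; split=> // -[u [Wu _] uv].
    apply: nw; have [Wv _] := vI; rewrite -uv in Wv.
    rewrite -(lker0_compfK (Weyl_lker rootD Wu) w).
    exact/(Weyl_comp Wv)/(Weyl_inv rootD).
  have nWV : ~ Weyl dot Delta (w1^-1)%VF.
    by move=> /(Weyl_inv rootD); rewrite lfun_invK.
  have e1 : WI `\` w1WI = WI := WD _ nW.
  have e2 : WI `\` w1invWI = WI := WD _ nWV.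
  by rewrite e1 e2 half.
have flip : \sum_(v \in WI `&` w1WI) term v = - \sum_(v \in WI `&` w1invWI) term v.
  rewrite (@reindex_fsbig _ _ _ _ _ (fun v => (w1 \o v)%VF) (WI `&` w1invWI)).
    rewrite -mulN1r mulr_fsumr; apply: eq_fsbigr => v /set_mem[[Wv _] _].
    by rewrite mulN1r; apply: chamber_sum_odd.
  split=> [x [xI [u uI ux]]|u v _ _ e|x [xI [u uI ux]]].
  - rewrite -ux lker0_compVKf //; split=> //.
    by exists x => //; rewrite -ux lker0_compVKf.
  - by rewrite -[u](lker0_compKf kw1) e lker0_compKf.
  - exists u => //; split=> //.
    by exists x => //; rewrite -ux lker0_compKf.
have sumD B : \sum_(v \in WI) term v =
    \sum_(v \in WI `&` B) term v + \sum_(v \in WI `\` B) term v.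
  by rewrite (fsbigID B).
(* Write the sum twice, split once along [w1WI] and once along [w1invWI]; on averaging, the two
   intersections cancel by [flip]. *)
have main : \sum_(v \in WI) term v =
    2^-1 * (\sum_(v \in WI `\` w1WI) term v + \sum_(v \in WI `\` w1invWI) term v).
  rewrite -[LHS]half {1}(sumD w1WI) (sumD w1invWI) flip.
  by rewrite addrACA addNr add0r.
by split=> // e; rewrite main e half.
Qed.
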